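(* Let $G$ be a \{finitely generated free\}-by-cyclic group with unipotent and polynomially growing monodromy. Let $S\subseteq G$ be a finite collection of non-trivial elements and let $g,h\in G$ be such that $\langle g\rangle\cap\langle h\rangle=1$ or $[g,h]\neq1$. Then there exists an integer $N$ (depending on $S$, $g$ and $h$) such that for every prime $p>N$ there is a $p$-periodic quotient $\pi\colon G\twoheadrightarrow Q$ such that the image of each element of $S$ is non-trivial in $Q$ and $\langle\pi(g)\rangle\cap\langle\pi(h)\rangle=1$.
   Context: A group is $p$-periodic if every non-trivial element of it has order $p$. $[g,h]=g^{-1}h^{-1}gh$. A \{finitely generated free\}-by-cyclic group is a group $G$ with an epimorphism $\chi\colon G\to\mathbb{Z}$ whose kernel $F$ is free of finite rank; conjugation by an element $t\in\chi^{-1}(1)$ induces an automorphism of $F$ whose class $\Phi\in\mathrm{Out}(F)$ is called the monodromy. ''With monodromy having property P'' means that for some such $\chi$ the monodromy has property P. $\Phi$ is unipotent if it induces a unipotent element of $\mathrm{GL}(H_1(F;\mathbb{Z}))$. Growth: fix a free basis $X$ of $F$; for a conjugacy class $\bar g$ let $|\bar g|_X$ be the word length of a shortest representative. The class $\bar g$ grows polynomially of degree $d$ under $\Phi$ if there are constants $A,B>0$ with $Ak^d-A\leq|\Phi^k(\bar g)|_X\leq Bk^d$ for all $k\geq1$. $\Phi$ grows polynomially of degree $d$ if every conjugacy class grows polynomially of degree $\leq d$ and some class grows polynomially of degree exactly $d$; $\Phi$ is polynomially growing if this holds for some integer $d\geq0$. *)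

(* Defs.v *)
From HB Require Import structures.
From mathcomp Require Import all_boot all_algebra.
From mathcomp Require Import generic_quotient boolp classical_sets reals.

Set Implicit Arguments.
Unset Strict Implicit.
Unset Printing Implicit Defensive.

Import GRing.Theory Num.Theory.

Local Open Scope group_scope.
Local Open Scope classical_set_scope.
Local Open Scope quotient_scope.

(* The group of integers, written multiplicatively: [z : infinite_cyclic] is
   convertible to [z : int], and [x * y], [1], [x^-1] to [x + y], [0], [- x]. *)
Definition infinite_cyclic : groupType := Algebra.to_multiplicative int.

Fact gmorph1 (G H : groupType) (f : {multiplicative G -> H}) : f 1 = 1.
Proof. by apply: (mulgI (f 1)); rewrite -gmulfM !mulg1. Qed.

Fact gmorphV (G H : groupType) (f : {multiplicative G -> H}) :
  {morph f : x / x^-1}.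
Proof.
by move=> x; apply: (mulgI (f x)); rewrite -gmulfM !mulgV gmorph1.
Qed.

Definition surjectiveg (G H : groupType) (f : {multiplicative G -> H}) : Prop :=
  forall y : H, exists x : G, f x = y.

Definition cyclic_subgroup (G : groupType) (x : G) : set G :=
  [set y | exists k : nat, y = x ^+ k \/ y = x ^- k].

Definition has_order (G : groupType) (x : G) (m : nat) : Prop :=
  [/\ (0 < m)%N, x ^+ m = 1 & forall k, (0 < k < m)%N -> x ^+ k <> 1].

Definition periodic (p : nat) (G : groupType) : Prop :=
  forall x : G, x <> 1 -> has_order x p.

Section Kernel.
Variables (G H : groupType) (f : {multiplicative G -> H}).

Definition in_kernel : {pred G} := fun x => f x == 1.

Fact in_kernel_group_closed : group_closed in_kernel.
Proof.
split=> [|x y]; rewrite !unfold_in ?gmorph1 // => /eqP fx /eqP fy.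
by rewrite gmulfM gmorphV fx fy divg1.
Qed.

Definition kernel := {x : G | in_kernel x}.

HB.instance Definition _ := SubChoice.on kernel.
HB.instance Definition _ :=
  SubChoice_isSubGroup.Build G in_kernel kernel in_kernel_group_closed.

Fact in_kernel_conj (t : G) (x : kernel) : in_kernel (t * val x * t^-1).
Proof.
have /eqP fx : f (val x) == 1 := valP x.
by rewrite /in_kernel !gmulfM fx mulg1 -gmulfM mulgV gmorph1.
Qed.

(* The class of [kernel_conj f t] in Out (kernel f) depends only on [f t]. *)
Definition kernel_conj (t : G) (x : kernel) : kernel :=
  Sub (t * val x * t^-1) (in_kernel_conj t x).

Fact kernel_conjM (t : G) : {morph kernel_conj t : x y / x * y}.
Proof.
by move=> x y; apply: val_inj; rewrite /= !mulgA mulgVK.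
Qed.

HB.instance Definition _ (t : G) :=
  isMultiplicative.Build kernel kernel (kernel_conj t) (@kernel_conjM t).

End Kernel.

Arguments kernel_conj {G H} f t x.

Section Abelianization.
Variable G : groupType.

(* Products of commutators form a subgroup, as [~ x, y]^-1 = [~ y, x]. *)
Definition derived : {pred G} := fun x =>
  `[< exists s : seq (G * G), x = \prod_(u <- s) [~ u.1, u.2] >].

Fact derivedP (x : G) :
  reflect (exists s : seq (G * G), x = \prod_(u <- s) [~ u.1, u.2])
          (x \in derived).
Proof. exact: asboolP. Qed.

Fact derivedR (x y : G) : [~ x, y] \in derived.
Proof. by apply/derivedP; exists [:: (x, y)]; rewrite big_seq1. Qed.

Fact derived_group_closed : group_closed derived.
Proof.
split=> [|x y]; first by apply/derivedP; exists [::]; rewrite big_nil.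
move=> /derivedP[s ->] /derivedP[r ->]; apply/derivedP.
exists (s ++ rev [seq (u.2, u.1) | u <- r]).
rewrite big_cat /= -map_rev big_map; congr (_ * _).
rewrite -{1}(revK r) -prodgV.
by apply: eq_bigr => u _; rewrite invgR.
Qed.

HB.instance Definition _ := isMulClosed.Build G derived
  (group_closedM derived_group_closed).
HB.instance Definition _ := isMul1Closed.Build G derived
  (fst derived_group_closed).
HB.instance Definition _ := isInvClosed.Build G derived
  (group_closedV derived_group_closed).

Fact derivedJ (x y : G) : x \in derived -> x ^ y \in derived.
Proof.
move=> dx; have -> : x ^ y = x * [~ x, y] by rewrite commgEl mulVKg.
by rewrite gpredM // derivedR.
Qed.

Definition derived_eq (x y : G) : bool := x^-1 * y \in derived.

Fact derived_eq_refl : reflexive derived_eq.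
Proof. by move=> x; rewrite /derived_eq mulVg gpred1. Qed.

Fact derived_eq_sym : symmetric derived_eq.
Proof. by move=> x y; rewrite /derived_eq -gpredV invgM invgK. Qed.

Fact derived_eq_trans : transitive derived_eq.
Proof.
move=> y x z dxy dyz; rewrite /derived_eq.
by have := gpredM _ _ dxy dyz; rewrite mulgA mulgK.
Qed.

Canonical derived_equiv :=
  EquivRel derived_eq derived_eq_refl derived_eq_sym derived_eq_trans.

Definition abelianization := {eq_quot derived_equiv}.

HB.instance Definition _ := Choice.on abelianization.
HB.instance Definition _ := EqQuotient.on abelianization.

Definition abel (x : G) : abelianization := \pi_abelianization%qT x.

Fact abelP (x y : G) : reflect (abel x = abel y) (x^-1 * y \in derived).
Proof.
by apply: (iffP idP) => [dxy|/eqmodP //]; apply/eqmodP.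
Qed.

Fact abel_repr (a : abelianization) : abel (repr a) = a.
Proof. exact: reprK. Qed.

Definition abel_add (a b : abelianization) := abel (repr a * repr b).
Definition abel_opp (a : abelianization) := abel (repr a)^-1.

Fact abelM (x y : G) : abel (x * y) = abel_add (abel x) (abel y).
Proof.
have /abelP dx := esym (abel_repr (abel x)).
have /abelP dy := esym (abel_repr (abel y)).
apply/abelP; set x' := repr _ in dx *; set y' := repr _ in dy *.
have -> : (x * y)^-1 * (x' * y') = (x^-1 * x') ^ y * (y^-1 * y').
  by rewrite conjgE invgM !mulgA mulgK.
by rewrite gpredM // derivedJ.
Qed.

Fact abelV (x : G) : abel x^-1 = abel_opp (abel x).
Proof.
have /abelP dx := abel_repr (abel x); apply/abelP; rewrite invgK.
set x' := repr _ in dx *.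
have -> : x * x'^-1 = (x'^-1 * x) ^ x'^-1 by rewrite conjgE invgK !mulgA mulgV mul1g.
exact: derivedJ.
Qed.

Fact abel_addA : associative abel_add.
Proof.
move=> a b c; rewrite -[a]abel_repr -[b]abel_repr -[c]abel_repr.
by rewrite -!abelM mulgA.
Qed.

Fact abel_addC : commutative abel_add.
Proof.
move=> a b; rewrite -[a]abel_repr -[b]abel_repr -!abelM; apply/abelP.
by rewrite invgM -mulgA; apply: derivedR.
Qed.

Fact abel_add0 : left_id (abel 1) abel_add.
Proof. by move=> a; rewrite -[a]abel_repr -abelM mul1g. Qed.

Fact abel_addN : left_inverse (abel 1) abel_opp abel_add.
Proof. by move=> a; rewrite -[a]abel_repr -abelV -abelM mulVg. Qed.

HB.instance Definition _ := GRing.isZmodule.Build abelianization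
  abel_addA abel_addC abel_add0 abel_addN.

End Abelianization.

(* The map induced on abelianizations; it does not depend on the chosen
   representatives by [abel_map_abel]. *)
Definition abel_map (G H : groupType) (f : {multiplicative G -> H})
  (a : abelianization G) : abelianization H := abel (f (repr a)).

Fact abel_map_abel (G H : groupType) (f : {multiplicative G -> H}) (x : G) :
  abel_map f (abel x) = abel (f x).
Proof.
have /abelP/derivedP[s ds] := abel_repr (abel x).
apply/abelP; rewrite -gmorphV -gmulfM ds; apply/derivedP.
exists [seq (f u.1, f u.2) | u <- s]; rewrite big_map.
rewrite (big_morph f (@gmulfM _ _ f) (gmorph1 f)); apply: eq_bigr => u _ /=.
by rewrite !commgEl !conjgE !gmulfM !gmorphV.
Qed.

Local Open Scope ring_scope.

(* u - 1 is nilpotent in the endomorphism ring of A. *)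
Definition unipotent_map (A : zmodType) (u : A -> A) : Prop :=
  exists m : nat, forall a : A, iter m (fun b => u b - b) a = 0.

(* H_1(F; Z) is the abelianization of F. *)
Definition unipotent (F : groupType) (phi : {multiplicative F -> F}) : Prop :=
  unipotent_map (abel_map phi).

Local Close Scope ring_scope.

Definition free_basis (F : groupType) (n : nat) (X : 'I_n -> F) : Prop :=
  forall (H : groupType) (y : 'I_n -> H),
    exists f : {multiplicative F -> H},
      (forall i, f (X i) = y i) /\
      forall g : {multiplicative F -> H}, (forall i, g (X i) = y i) -> g =1 f.

Section Growth.
Variables (R : realType) (F : groupType) (n : nat) (X : 'I_n -> F).

(* The letter (i, true) stands for the inverse of X i. *)
Definition word_value (w : seq ('I_n * bool)) : F :=
  \prod_(u <- w) (if u.2 then (X u.1)^-1 else X u.1).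

Definition conjugate (x y : F) : Prop := exists z : F, y = x ^ z.

Definition spells_conjugate (x : F) (m : nat) : Prop :=
  exists w : seq ('I_n * bool), size w = m /\ conjugate x (word_value w).

(* Length of a shortest word representing an element of the conjugacy class of
   x; the default value 0 is only taken when no such word exists, hence never
   when X generates F. *)
Definition conj_length (x : F) : nat :=
  xget 0%N [set m | spells_conjugate x m /\
                    forall k, spells_conjugate x k -> (m <= k)%N].

Variable phi : F -> F.

Local Open Scope ring_scope.

Definition class_grows (x : F) (d : nat) : Prop :=
  exists A B : R, [/\ 0 < A, 0 < B & forall k : nat, (1 <= k)%N ->
    A * k%:R ^+ d - A <= (conj_length (iter k phi x))%:R <= B * k%:R ^+ d].

Definition grows_polynomially (d : nat) : Prop :=
  (forall x : F, exists2 e : nat, (e <= d)%N & class_grows x e) /\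
  (exists x : F, class_grows x d).

Definition polynomially_growing : Prop := exists d : nat, grows_polynomially d.

End Growth.

(* Main.v *)
Require Import Defs.
From HB Require Import structures.
From mathcomp Require Import all_boot all_algebra order generic_quotient.
From mathcomp Require Import boolp classical_sets functions reals.
From mathcomp Require Import ring zify.

Set Implicit Arguments.
Unset Strict Implicit.
Unset Printing Implicit Defensive.

Import Order.TTheory GRing.Theory Num.Theory.

Local Open Scope group_scope.
Local Open Scope classical_set_scope.

(** The idea is to test elements of [G] with polynomial maps to the integers:
maps [u] annihilated by every composite of [c] difference operators
[dif g u x = u (g x) - u x].

Given [p], call two elements congruent when they translate every polynomial map
killed by [p] differences in the same way modulo [p].  The quotient [Q] of [G]
by this congruence has exponent [p]: expanding [u (x ^ p y)] binomially leaves
[u y] and terms multiplied by 'C(p, i) with [0 < i < p]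
([congruence_quotient_exponent]).  If some integral polynomial map [u]
separates [x] from [1], then [x] survives in [Q] for every [p] larger than both
the number of differences that kill [u] and the integer [`|u x - u 1|].  So the survival of finitely
many elements follows from [free_by_cyclic_separated]: polynomial maps separate
the elements of [G].

Elements outside the kernel [F] of [chi] are separated from [1] by [chi].  On
[F], the entries of a unitriangular representation are polynomial, and a
nontrivial reduced word is detected by the one that sends a basis element to
the sum of [1] and of the elementary matrices at the positions of the word
where it occurs; this is a finite piece of the Magnus embedding.  To carry
a polynomial map on [F] over to [G], let [G] act on [F], the kernel by
translations and [t] by the monodromy [phi].  What is needed is that [phi - 1]
acts nilpotently on the polynomial maps of bounded degree on [F]
([iter_shift_poly_map]).  Modulo lower degree, [dif y v] is additive in [y], so
it only depends on the class of [y] in the abelianization, where [phi] is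
unipotent; induction on the degree concludes.

As to the cyclic subgroups, in a group of prime exponent two of them meet
nontrivially only if [pi h] is a power [pi g ^ k].  If [g] and [h] do not
commute this is excluded as soon as their commutator survives.  Otherwise
choose [u] and [y] with [u (g ^ i y) = u y + i a] and [a > 0].  With
[b = u (h y) - u y], the relation [pi h = pi g ^ k] forces [k a = b] modulo
[p], hence [pi (h ^ a) = pi (g ^ b)].  But [a] and [b] do not depend on [p], and
[h ^ a] differs from [g ^ b] because [h] has infinite order and the cyclic
subgroups of [g] and [h] meet trivially; so this fails for large [p]. *)

(** * Powers with integer exponents *)

Lemma gmorphX (G H : groupType) (f : {multiplicative G -> H}) n :
  {morph f : x / x ^+ n}.
Proof.
by move=> x; elim: n => [|n IH]; rewrite ?gmorph1 // !expgS gmulfM IH.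
Qed.

Section IntegerPower.
Variable G : groupType.
Implicit Types (x : G) (e : int).

Definition zpow x e : G :=
  match e with Posz k => x ^+ k | Negz k => x ^- k.+1 end.

Lemma zpowS x e : zpow x (e + 1)%R = x * zpow x e.
Proof.
case: e => [k|[|k]].
- by rewrite (_ : (_ + _)%R = Posz k.+1) /= ?expgS //; lia.
- by rewrite (_ : (_ + _)%R = Posz 0) /= ?expg1 ?mulgV //; lia.
rewrite (_ : (_ + _)%R = Negz k) /=; last lia.
by rewrite [x ^+ k.+2]expgSr invgM mulVKg.
Qed.

Lemma zpowP x e : zpow x (e - 1)%R = x^-1 * zpow x e.
Proof. by apply: (mulgI x); rewrite -zpowS mulVKg GRing.subrK. Qed.

Lemma zpow_cyclic x e : cyclic_subgroup x (zpow x e).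
Proof. by case: e => k; [exists k; left|exists k.+1; right]. Qed.

Lemma zpowD x (a b : int) : zpow x (a + b)%R = zpow x a * zpow x b.
Proof.
elim/int_ind: a => [|k IH|k IH].
- by rewrite add0r mul1g.
- rewrite (_ : Posz k.+1 + b = Posz k + b + 1)%R; last by lia.
  by rewrite zpowS IH mulgA -zpowS intS addrC.
- rewrite (_ : - Posz k.+1 + b = - Posz k + b - 1)%R; last by lia.
  rewrite zpowP IH mulgA -zpowP.
  by rewrite (_ : - Posz k - 1 = - Posz k.+1)%R //; lia.
Qed.

Lemma zpow_modp p x k e :
  x ^+ p = 1 -> (p %| (Posz k - e)%R)%Z -> x ^+ k = zpow x e.
Proof.
move=> xp /dvdzP[q kq].
have zpowp (i : int) : zpow x (i * p)%R = 1.
  elim/int_ind: i => [|i IH|i IH].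
  - by rewrite mul0r.
  - by rewrite (_ : Posz i.+1 * p = Posz i * p + p)%R ?zpowD ?IH ?mul1g //; nia.
  - have := zpowD x (- Posz i.+1 * p)%R p.
    rewrite (_ : - Posz i.+1 * p + p = - Posz i * p)%R; last by nia.
    by rewrite IH /= xp mulg1.
rewrite -[x ^+ k]/(zpow x k) (_ : Posz k = q * p + e)%R.
  by rewrite zpowD zpowp mul1g.
by rewrite -kq subrK.
Qed.

End IntegerPower.

Lemma gmorph_zpow (G H : groupType) (f : {multiplicative G -> H}) x e :
  f (zpow x e) = zpow (f x) e.
Proof. by case: e => k /=; rewrite ?gmorphV gmorphX. Qed.

(** * Vectors annihilated by long products of operators *)

Section Killed.
Local Open Scope ring_scope.
Variables (V : zmodType) (I : Type) (T : I -> V -> V).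
Hypothesis TB : forall i, {morph T i : u v / u - v}.

Fixpoint killed (c : nat) (v : V) : Prop :=
  if c is c'.+1 then forall i, killed c' (T i v) else v = 0.

Lemma killedB c u v : killed c u -> killed c v -> killed c (u - v).
Proof.
elim: c u v => [|c IH] u v /=; first by move=> -> ->; rewrite subr0.
by move=> ku kv i; rewrite TB; apply: IH.
Qed.

Lemma killed0 c : killed c 0.
Proof.
elim: c => //= c IH i.
by have := TB i 0 0; rewrite !subrr => ->.
Qed.

Lemma killedN c v : killed c v -> killed c (- v).
Proof. by rewrite -[- v]sub0r; apply: killedB; apply: killed0. Qed.

Lemma killedD c u v : killed c u -> killed c v -> killed c (u + v).
Proof. by move=> ku kv; rewrite -[v]opprK; apply/killedB/killedN. Qed.

Lemma killed_leq c d v : (c <= d)%N -> killed c v -> killed d v.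
Proof.
elim: d c v => [|d IH] [|c] v //=.
  by move=> _ ->; apply: (@killed0 d.+1).
by move=> le_cd kv i; apply: (IH c).
Qed.

(** This yields invariance under translations and automorphisms, which permute
the difference operators by conjugation. *)
Lemma killed_twist (S : V -> V) c v : S 0 = 0 ->
    (forall i w, exists j, T i (S w) = S (T j w)) ->
  killed c v -> killed c (S v).
Proof.
move=> S0 TS; elim: c v => [|c IH] v /=; first by move->.
by move=> kv i; have [j ->] := TS i v; apply: IH.
Qed.

End Killed.

(** * Polynomial maps from a group to the integers *)

Section PolynomialMaps.
Variable G : groupType.
Implicit Types (u : G -> int) (g x y : G).
Local Open Scope ring_scope.

Definition dif g u : G -> int := fun x => u (g * x)%g - u x.

Lemma difB g : {morph dif g : u v / u - v}.
Proof. by move=> u v; apply/funext=> x; rewrite /dif !fctE; ring. Qed.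

Definition poly_map : nat -> (G -> int) -> Prop := killed dif.

Lemma poly_map_left a c u : poly_map c u -> poly_map c (fun x => u (a * x)%g).
Proof.
apply: (@killed_twist _ _ dif (fun u x => u (a * x)%g)) => // g w.
by exists (a * g * a^-1)%g; apply/funext=> x; rewrite /dif !mulgA mulgVK.
Qed.

(** Newton's forward difference formula: with [D = dif x], translation by [x]
is [1 + D], so translation by [x ^+ k] is the binomial sum, which stops where
the powers of [D] vanish. *)
Lemma dif_expg c x u k y : iter c (dif x) u = 0 ->
  u (x ^+ k * y)%g = \sum_(i < c) iter i (dif x) u y *+ 'C(k, i).
Proof.
elim: c u k y => [|c IH] u k y; first by move=> /= ->; rewrite big_ord0.
rewrite iterSr => /IH {}IH; rewrite big_ord_recl /= bin0 mulr1n.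
elim: k => [|k IHk].
  rewrite expg0 mul1g big1 ?addr0 //.
have -> : u (x ^+ k.+1 * y)%g = u (x ^+ k * y)%g + dif x u (x ^+ k * y)%g.
  by rewrite /dif expgS mulgA addrC subrK.
rewrite IHk IH -addrA -big_split /=; congr (_ + _).
apply: eq_bigr => i _.
by rewrite /bump /= add1n add0n binS mulrnDr -iterS iterSr addrC.
Qed.

Lemma poly_map_iter c x u : poly_map c u -> iter c (dif x) u = 0.
Proof. by elim: c u => [|c IH] u //= ku; rewrite -iterS iterSr; apply: IH. Qed.

End PolynomialMaps.

(** * Groups of prime exponent *)

Section PrimeExponent.
Variables (H : groupType) (p : nat) (p_pr : prime p).
Hypothesis expH : forall a : H, a ^+ p = 1.

Lemma prime_exponent_periodic : periodic p H.
Proof.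
move=> x x1; split=> //; first exact: prime_gt0.
move=> k /andP[k0 kp] xk; apply: x1.
have [a b e _] := egcdnP p k0.
have kp1 : gcdn k p = 1%N.
  by apply/eqP; rewrite -/(coprime k p) coprime_sym prime_coprime // gtnNdvd.
rewrite -(expg1 x) -kp1.
have : x ^+ (a * k)%N = x ^+ (b * p + gcdn k p)%N by rewrite e.
by rewrite mulnC expgnA xk expg1n expgnDr mulnC expgnA expH expg1n mul1g.
Qed.

(** A common nontrivial element generates both subgroups, as they have prime
order. *)
Lemma cyclic_meet_generator (g h : H) :
    cyclic_subgroup g `&` cyclic_subgroup h <> [set 1] ->
  exists k, h = g ^+ k.
Proof.
have nat_exp (a x : H) : cyclic_subgroup a x -> exists k, x = a ^+ k.
  move=> [k [->|->]]; first by exists k.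
  exists (k * p.-1)%N; apply: (mulgI (a ^+ k)); rewrite mulgV -expgnDr.
  rewrite -{1}(muln1 k) -mulnDr add1n prednK ?prime_gt0 //.
  by rewrite mulnC expgnA expH expg1n.
move=> meet; apply: contrapT => no_k; apply: meet; apply/seteqP; split=> x /=.
  move=> [/nat_exp[a xa] /nat_exp[b xb]]; apply: contrapT => x1.
  have b0 : (0 < b)%N by case: b xb => // xb; case: x1; rewrite xb.
  apply: no_k.
  have [c d e _] := egcdnP p b0.
  have bp1 : gcdn b p = 1%N.
    apply/eqP; rewrite -/(coprime b p) coprime_sym prime_coprime //.
    apply/negP=> /dvdnP[q bq]; apply: x1.
    by rewrite xb bq mulnC expgnA expH expg1n.
  exists (a * c)%N; rewrite expgnA -xa xb -expgnA mulnC e bp1 expgnDr expg1.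
  by rewrite mulnC expgnA expH expg1n mul1g.
by move=> ->; split; exists 0%N; left; rewrite expg0.
Qed.

End PrimeExponent.

(** * Quotients by normal subgroups *)

(** The predicate is bundled with its closure properties so that the coset
relation can be declared as an equivalence for each such predicate. *)
Record normal_subgroup (G : groupType) := NormalSubgroup {
  normal_pred :> {pred G};
  normal_closed : group_closed normal_pred;
  normal_conj : forall x y, x \in normal_pred -> x ^ y \in normal_pred }.

Section Quotient.
Local Open Scope quotient_scope.
Variables (G : groupType) (K : normal_subgroup G).

Lemma normal1 : 1 \in K. Proof. by case: (normal_closed K). Qed.
Lemma normalM x y : x \in K -> y \in K -> x * y \in K.
Proof. exact: (group_closedM (normal_closed K)). Qed.
Lemma normalV x : x \in K -> x^-1 \in K.
Proof. exact: (group_closedV (normal_closed K)). Qed.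

Definition coset_eq (x y : G) : bool := x^-1 * y \in K.

Lemma coset_eq_refl : reflexive coset_eq.
Proof. by move=> x; rewrite /coset_eq mulVg normal1. Qed.

Lemma coset_eq_sym : symmetric coset_eq.
Proof.
by move=> x y; rewrite /coset_eq; apply/idP/idP=> /normalV;
   rewrite invgM invgK.
Qed.

Lemma coset_eq_trans : transitive coset_eq.
Proof.
move=> y x z dxy dyz; rewrite /coset_eq.
by have := normalM dxy dyz; rewrite mulgA mulgK.
Qed.

Canonical coset_equiv :=
  EquivRel coset_eq coset_eq_refl coset_eq_sym coset_eq_trans.

Definition quotient_group := {eq_quot coset_equiv}.

HB.instance Definition _ := Choice.on quotient_group.
HB.instance Definition _ := EqQuotient.on quotient_group.

Definition quotient_map (x : G) : quotient_group := \pi_quotient_group%qT x.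

Lemma quotient_mapP x y :
  reflect (quotient_map x = quotient_map y) (x^-1 * y \in K).
Proof. by apply: (iffP idP) => [dxy|/eqmodP //]; apply/eqmodP. Qed.

Lemma quotient_map_repr a : quotient_map (repr a) = a.
Proof. exact: reprK. Qed.

Definition quotient_mul (a b : quotient_group) :=
  quotient_map (repr a * repr b).
Definition quotient_inv (a : quotient_group) := quotient_map (repr a)^-1.

Lemma quotient_mapM x y :
  quotient_map (x * y) = quotient_mul (quotient_map x) (quotient_map y).
Proof.
have /quotient_mapP dx := esym (quotient_map_repr (quotient_map x)).
have /quotient_mapP dy := esym (quotient_map_repr (quotient_map y)).
apply/quotient_mapP; set x' := repr _ in dx *; set y' := repr _ in dy *.
have -> : (x * y)^-1 * (x' * y') = (x^-1 * x') ^ y * (y^-1 * y').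
  by rewrite conjgE invgM !mulgA mulgK.
by rewrite normalM // normal_conj.
Qed.

Lemma quotient_mapV x : quotient_map x^-1 = quotient_inv (quotient_map x).
Proof.
have /quotient_mapP dx := quotient_map_repr (quotient_map x).
apply/quotient_mapP; rewrite invgK.
set x' := repr _ in dx *.
have -> : x * x'^-1 = (x'^-1 * x) ^ x'^-1.
  by rewrite conjgE invgK !mulgA mulgV mul1g.
exact: normal_conj.
Qed.

Lemma quotient_mulA : associative quotient_mul.
Proof.
move=> a b c; rewrite -[a]quotient_map_repr -[b]quotient_map_repr.
by rewrite -[c]quotient_map_repr -!quotient_mapM mulgA.
Qed.

Lemma quotient_mul1 : left_id (quotient_map 1) quotient_mul.
Proof. by move=> a; rewrite -[a]quotient_map_repr -quotient_mapM mul1g. Qed.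

Lemma quotient_mulr1 : right_id (quotient_map 1) quotient_mul.
Proof. by move=> a; rewrite -[a]quotient_map_repr -quotient_mapM mulg1. Qed.

Lemma quotient_mulV : left_inverse (quotient_map 1) quotient_inv quotient_mul.
Proof.
by move=> a; rewrite -[a]quotient_map_repr -quotient_mapV -quotient_mapM mulVg.
Qed.

Lemma quotient_mulrV : right_inverse (quotient_map 1) quotient_inv quotient_mul.
Proof.
by move=> a; rewrite -[a]quotient_map_repr -quotient_mapV -quotient_mapM mulgV.
Qed.

HB.instance Definition _ := isGroup.Build quotient_group
  quotient_mulA quotient_mul1 quotient_mulr1 quotient_mulV quotient_mulrV.
HB.instance Definition _ :=
  isMultiplicative.Build G quotient_group quotient_map quotient_mapM.

End Quotient.

(** * The congruence defined by polynomial maps modulo a prime *)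

Section PolynomialCongruence.
Variables (G : groupType) (p : nat).
Local Open Scope ring_scope.

(** Bounding the number of differences by [p] itself makes every polynomial map
admissible once [p] is large, and is what the binomial formula needs to give
exponent [p]. *)
Definition congruent (x y : G) : Prop :=
  forall u, poly_map p u -> forall z, (p %| u (x * z)%g - u (y * z)%g)%Z.

Definition congruence_kernel : {pred G} := fun x => `[< congruent x 1%g >].

Lemma congruence_kernelP x y :
  reflect (congruent x y) ((x^-1 * y)%g \in congruence_kernel).
Proof.
apply: (iffP (asboolP _)) => [cxy|cxy] u pu z.
  have := cxy _ (poly_map_left x pu) z.
  by rewrite mul1g !mulgA mulgV mul1g rpredBC.
have := cxy _ (poly_map_left x^-1%g pu) z.
by rewrite mul1g rpredBC !mulgA mulVg mul1g.
Qed.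

Lemma congruence_kernel_closed : group_closed congruence_kernel.
Proof.
split=> [|x y /asboolP cx /asboolP cy].
  by apply/asboolP=> u _ z; rewrite subrr dvdz0.
apply/asboolP=> u pu z.
have := cx u pu (y^-1 * z)%g; have := cy u pu (y^-1 * z)%g.
rewrite !mul1g !mulgA mulgV mul1g => dy dx.
have := rpredB dx dy; rewrite opprB addrA subrK; exact.
Qed.

Lemma congruence_kernelJ x y :
  x \in congruence_kernel -> (x ^ y)%g \in congruence_kernel.
Proof.
move=> /asboolP cx; apply/asboolP=> u pu z.
have := cx _ (poly_map_left y^-1%g pu) (y * z)%g.
by rewrite !mul1g mulKg conjgE !mulgA.
Qed.

Definition congruence_normal : normal_subgroup G :=
  NormalSubgroup congruence_kernel_closed congruence_kernelJ.

Definition congruence_quotient := quotient_group congruence_normal.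

Definition congruence_map : {multiplicative G -> congruence_quotient} :=
  quotient_map congruence_normal.

Lemma congruence_mapP x y :
  congruence_map x = congruence_map y <-> congruent x y.
Proof.
by split=> [/(quotient_mapP congruence_normal)/congruence_kernelP
           |/congruence_kernelP/(quotient_mapP congruence_normal)].
Qed.

Lemma congruence_map_surj : surjectiveg congruence_map.
Proof. by move=> y; exists (repr y); apply: quotient_map_repr. Qed.

(** In the binomial formula for translation by [x ^+ p], the terms of order
[0 < i < p] are divisible by [p] and those of order at least [p] vanish. *)
Lemma congruence_map_expg x : prime p -> congruent (x ^+ p)%g 1%g.
Proof.
move=> p_pr u pu z; rewrite (dif_expg p z (poly_map_iter x pu)).
have := prime_gt0 p_pr; case: p p_pr => // q q_pr _.
rewrite big_ord_recl /= bin0 mulr1n mul1g addrAC subrr add0r.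
apply: rpred_sum => i _; rewrite -mulr_natr dvdz_mull //.
by rewrite natz dvdzE /= prime_dvd_bin //= /bump /= ltnS.
Qed.

Lemma congruence_quotient_exponent (a : congruence_quotient) :
  prime p -> (a ^+ p = 1)%g.
Proof.
move=> p_pr; have [x <-] := congruence_map_surj a.
rewrite -gmorphX -(gmorph1 congruence_map).
exact/congruence_mapP/congruence_map_expg.
Qed.

End PolynomialCongruence.

Arguments congruence_map {G} p.

(** * Reduced words in a free group *)

Section FreeWords.
Variables (F : groupType) (n : nat) (X : 'I_n -> F).

Definition generated : {pred F} := fun x => `[< exists w, x = word_value X w >].

Lemma word_value_cat w1 w2 :
  word_value X (w1 ++ w2) = word_value X w1 * word_value X w2.
Proof. by rewrite /word_value big_cat. Qed.

Lemma generated_closed : group_closed generated.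
Proof.
split=> [|x y /asboolP[w1 ->] /asboolP[w2 ->]].
  by apply/asboolP; exists [::]; rewrite /word_value big_nil.
apply/asboolP; exists (w1 ++ rev [seq (l.1, ~~ l.2) | l <- w2]).
rewrite word_value_cat; congr (_ * _).
rewrite /word_value -map_rev big_map -{1}(revK w2) -prodgV.
by apply: eq_bigr => -[i []] _ /=; rewrite ?invgK.
Qed.

Definition generated_group := {x : F | generated x}.

HB.instance Definition _ := SubChoice.on generated_group.
HB.instance Definition _ :=
  SubChoice_isSubGroup.Build F generated generated_group generated_closed.

(** By the universal property [F] maps to the subgroup generated by the basis;
followed by the inclusion this fixes the basis, so it is the identity. *)
Lemma free_basis_generates : free_basis X ->
  forall x, exists w, x = word_value X w.
Proof.
move=> X_basis x.
have genX i : generated (X i).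
  by apply/asboolP; exists [:: (i, false)]; rewrite /word_value big_seq1.
have [f [fX _]] := X_basis generated_group (fun i => Sub (X i) (genX i)).
have [g [_ g_uniq]] := X_basis F X.
have e : idfun x = (val \o f) x.
  rewrite (g_uniq idfun) //.
  symmetry.
  apply: (g_uniq (val \o f)) => i /=.
  by rewrite fX.
by have /asboolP[w] := valP (f x); exists w; rewrite -[LHS]/(idfun x) e.
Qed.

Definition syllable_value (s : seq ('I_n * int)) : F :=
  \prod_(a <- s) zpow (X a.1) a.2.

Definition reduced (s : seq ('I_n * int)) : bool :=
  sorted (fun a b => a.1 != b.1) s && all (fun a => a.2 != 0%R) s.

Lemma reduced_behead a s : reduced (a :: s) -> reduced s.
Proof.
by move=> /andP[/path_sorted ss /andP[_ sa]]; apply/andP.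
Qed.

(** Multiplying by a letter on the left either creates a new first syllable or
changes the exponent of the first one, which disappears if that exponent
becomes zero. *)
Lemma reduced_form w : exists2 s, reduced s & word_value X w = syllable_value s.
Proof.
elim: w => [|[i b] w [s s_red ws]].
  by exists [::]; rewrite // /word_value /syllable_value !big_nil.
pose d : int := if b then (-1)%R else 1%R.
have step e : zpow (X i) (e + d)%R =
    (if b then (X i)^-1 else X i) * zpow (X i) e.
  by rewrite /d; case: (b); [apply: zpowP|apply: zpowS].
rewrite /word_value big_cons -[X in _ * X]/(word_value X w) ws /=.
have step1 : (if b then (X i)^-1 else X i) = zpow (X i) d.
  by rewrite -[d]GRing.add0r step /= mulg1.
have [[[j e] [s' [es ij]]]|nij] :=
    pselect (exists a s', s = a :: s' /\ a.1 = i).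
  rewrite /= in ij; subst j s.
  rewrite /syllable_value big_cons /= mulgA -step.
  have [ed0|ed0] := eqVneq (e + d)%R 0%R.
    by exists s'; rewrite ?(reduced_behead s_red) // ed0 /= mul1g.
  exists ((i, (e + d)%R) :: s'); last by rewrite big_cons.
  move: s_red; rewrite /reduced /= ed0.
  by case: (s') => //= ? ? /andP[-> /andP[]].
exists ((i, d) :: s); last by rewrite step1 /syllable_value big_cons.
move: s_red nij; rewrite /reduced; case: s {ws} => [|a s] /=.
  by rewrite /d; case: (b).
move=> /andP[-> ->] nij; rewrite andbT /d.
apply/andP; split; last by rewrite ?andbT; case: (b).
by apply/eqP=> ia; apply: nij; exists a, s.
Qed.

End FreeWords.

(** * Polynomial maps separate the elements of a free group *)

Section RingUnits.
Variable R : unitRingType.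
Local Open Scope ring_scope.

Definition ring_unit := {a : R | a \is a GRing.unit}.

HB.instance Definition _ := SubChoice.on ring_unit.

Fact ring_unit1 : (1 : R) \is a GRing.unit. Proof. exact: unitr1. Qed.

Fact ring_unitM (a b : ring_unit) : val a * val b \is a GRing.unit.
Proof. by rewrite unitrMr (valP a, valP b). Qed.

Fact ring_unitV (a : ring_unit) : (val a)^-1 \is a GRing.unit.
Proof. by rewrite unitrV (valP a). Qed.

Definition unit_mul (a b : ring_unit) : ring_unit :=
  exist (fun x : R => x \is a GRing.unit) _ (ring_unitM a b).
Definition unit_one : ring_unit :=
  exist (fun x : R => x \is a GRing.unit) _ ring_unit1.
Definition unit_inv (a : ring_unit) : ring_unit :=
  exist (fun x : R => x \is a GRing.unit) _ (ring_unitV a).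

Fact unit_mulA : associative unit_mul.
Proof. by move=> a b c; apply: val_inj; rewrite /= mulrA. Qed.
Fact unit_mul1 : left_id unit_one unit_mul.
Proof. by move=> a; apply: val_inj; rewrite /= mul1r. Qed.
Fact unit_mulr1 : right_id unit_one unit_mul.
Proof. by move=> a; apply: val_inj; rewrite /= mulr1. Qed.
Fact unit_mulV : left_inverse unit_one unit_inv unit_mul.
Proof. by move=> a; apply: val_inj; rewrite /= mulVr // (valP a). Qed.
Fact unit_mulrV : right_inverse unit_one unit_inv unit_mul.
Proof. by move=> a; apply: val_inj; rewrite /= mulrV // (valP a). Qed.

HB.instance Definition _ := isGroup.Build ring_unit
  unit_mulA unit_mul1 unit_mulr1 unit_mulV unit_mulrV.

End RingUnits.

Section Unitriangular.
Variable m : nat.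
Implicit Types A B : 'M[int]_m.+1.
Local Open Scope ring_scope.

Definition unitriangular A : Prop :=
  forall i j : 'I_m.+1, (j <= i)%N -> A i j = (i == j)%:R.

Lemma unitriangularM A B :
  unitriangular A -> unitriangular B -> unitriangular (A * B).
Proof.
move=> uA uB i j ji; rewrite mxE (bigD1 i) //= uA // eqxx mul1r uB //.
rewrite big1 ?addr0 // => k ki.
have [ik|ik] := ltnP i k; last by rewrite uA // eq_sym (negPf ki) mul0r.
rewrite (uB k j); last by apply: leq_trans ji (ltnW ik).
case: eqP => [kj|_]; last by rewrite mulr0.
by move: ik; rewrite kj ltnNge ji.
Qed.

(** The difference of the entry in row [i] involves only the entries in rows
below [i], because the diagonal of [f g] consists of ones.  Hence an induction
on the number of rows from [i] to the bottom. *)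
Lemma unitriangular_poly_map (G : groupType) (f : G -> 'M[int]_m.+1)
    (i j : 'I_m.+1) :
    {morph f : x y / (x * y)%g >-> x * y} -> (forall x, unitriangular (f x)) ->
  poly_map (m.+1 - i) (fun x => f x i j).
Proof.
move=> fM uf; have [d] := ubnP (m.+1 - i)%N.
elim: d i => // d IH i; rewrite ltnS => le_d.
have -> : (m.+1 - i = (m - i).+1)%N by rewrite subSn // -ltnS.
move=> g.
have -> : dif g (fun x => f x i j) =
    \sum_(k < m.+1 | (i < k)%N) (fun x => f g i k * f x k j).
  apply/funext=> x; rewrite fct_sumE /dif fM mxE.
  rewrite (bigID (fun k : 'I_m.+1 => (i < k)%N)) /= addrC.
  rewrite (bigD1 i) ?ltnn //= uf // eqxx mul1r big1; last first.
    move=> k /andP[ki ni]; rewrite uf 1?leqNgt // eq_sym (negPf ni).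
    by rewrite mul0r.
  by rewrite addr0 addrAC subrr add0r.
apply: (big_ind (poly_map (m - i))) => [|u v pu pv|k ik].
- exact: (killed0 (@difB G)).
- exact: (killedD (@difB G)).
apply: (@killed_twist _ _ _ (fun (u : G -> int) x => f g i k * u x)).
- by apply/funext=> x; rewrite mulr0.
- by move=> h w; exists h; apply/funext=> x; rewrite /dif mulrBr.
apply: (killed_leq (@difB G) (c := m.+1 - k)); first by lia.
by apply: IH; have := ltn_ord k; lia.
Qed.

End Unitriangular.

Section Magnus.
Variables (F : groupType) (n : nat) (X : 'I_n -> F).
Hypothesis X_basis : free_basis X.
Variables (a : 'I_n * int) (s : seq ('I_n * int)).
Local Notation t := (a :: s).
Local Notation m := (size t).
Hypothesis t_red : reduced t.
Local Open Scope ring_scope.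

(** The sum of the elementary matrices E_(j, j+1) over the positions [j] where
the syllable [t_j] is a power of the basis element [i].  The default [a] is
never read, as column [j.+1] exists only for [j < m]. *)
Definition shift_mx (i : 'I_n) : 'M[int]_m.+1 :=
  \matrix_(j, k) ((k == j.+1 :> nat) && ((nth a t j).1 == i))%:R.

(** A nonzero entry of the square would come from two adjacent syllables with
the same basis element. *)
Lemma shift_mx_sq i : shift_mx i * shift_mx i = 0.
Proof.
apply/matrixP=> j k; rewrite !mxE big1 // => l _; rewrite !mxE -natrM mulnb.
case: eqP => //= lj; case: eqP => //= ji; case: eqP => //= kl.
rewrite lj -ji.
have jm : (j.+1 < m)%N by rewrite -lj -ltnS -kl.
case/andP: t_red => /(pathP a)/(_ j jm) /= ne _.
by rewrite eq_sym (negPf ne).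
Qed.

Lemma shift_mx_mulV i : (1 - shift_mx i) * (1 + shift_mx i) = 1.
Proof. by rewrite mulrBl mul1r mulrDr mulr1 shift_mx_sq addr0 addrK. Qed.

Lemma shift_mx_mulrV i : (1 + shift_mx i) * (1 - shift_mx i) = 1.
Proof. by rewrite mulrDl mul1r mulrBr mulr1 shift_mx_sq subr0 subrK. Qed.

Lemma shift_mx_unitr i : 1 + shift_mx i \is a GRing.unit.
Proof.
apply/unitrP; exists (1 - shift_mx i).
by rewrite shift_mx_mulV shift_mx_mulrV.
Qed.

Definition shift_unit (i : 'I_n) : ring_unit 'M[int]_m.+1 :=
  exist (fun x : 'M[int]_m.+1 => x \is a GRing.unit) _ (shift_mx_unitr i).

Lemma val_shift_unit i : val (shift_unit i) = 1 + shift_mx i.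
Proof. by []. Qed.

Lemma val_shift_unitV i : val (shift_unit i)^-1%g = 1 - shift_mx i.
Proof.
apply: (mulrI (shift_mx_unitr i)); rewrite shift_mx_mulrV.
by rewrite /= mulrV // shift_mx_unitr.
Qed.

Lemma val_shift_zpow i (e : int) :
  val (zpow (shift_unit i) e) = 1 + e *: shift_mx i.
Proof.
have step e' : val (zpow (shift_unit i) e') = 1 + e' *: shift_mx i ->
    val (zpow (shift_unit i) (e' + 1)) = 1 + (e' + 1) *: shift_mx i.
  move=> ee'; rewrite zpowS.
  rewrite [LHS](_ : _ = (1 + shift_mx i) * val (zpow (shift_unit i) e')) //.
  rewrite ee' mulrDl mul1r mulrDr mulr1 -scalerAr shift_mx_sq scaler0 addr0.
  by rewrite scalerDl scale1r addrA.
have stepV e' : val (zpow (shift_unit i) e') = 1 + e' *: shift_mx i ->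
    val (zpow (shift_unit i) (e' - 1)) = 1 + (e' - 1) *: shift_mx i.
  move=> ee'; rewrite zpowP.
  rewrite [LHS](_ : _ =
    val (shift_unit i)^-1%g * val (zpow (shift_unit i) e')) //.
  rewrite val_shift_unitV ee' mulrBl mul1r mulrDr mulr1 -scalerAr shift_mx_sq.
  by rewrite scaler0 addr0 scalerBl scale1r addrA.
elim/int_ind: e => [|k IH|k IH].
- by rewrite scale0r addr0.
- by rewrite (_ : Posz k.+1 = Posz k + 1); [apply: step|lia].
- by rewrite (_ : - Posz k.+1 = - Posz k - 1); [apply: stepV|lia].
Qed.

Definition magnus_row (k : nat) : 'rV[int]_m.+1 :=
  row ord0 (\prod_(b <- take k t) (1 + b.2 *: shift_mx b.1)).

(** Each factor moves the last nonzero entry of the row at most one place to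
the right.  It moves it exactly one place, multiplying it by the exponent,
because the syllable read at that moment is the one marked at that place. *)
Lemma magnus_rowE k : (k <= m)%N ->
  (forall j : 'I_m.+1, (k < j)%N -> magnus_row k ord0 j = 0) /\
  magnus_row k ord0 (inord k) = \prod_(b <- take k t) b.2.
Proof.
elim: k => [|k IH] km.
  rewrite /magnus_row take0 !big_nil; split=> [j j0|].
    by rewrite !mxE; case: eqP => // e; rewrite -e in j0.
  by rewrite !mxE -val_eqE /= inordK.
have [above diag] := IH (ltnW km).
have stepE (j : 'I_m.+1) : magnus_row k.+1 ord0 j = magnus_row k ord0 j +
    (nth a t k).2 * \sum_l magnus_row k ord0 l * shift_mx (nth a t k).1 l j.
  rewrite /magnus_row (take_nth a) // -cats1 big_cat big_seq1 /= mulrDr mulr1.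
  rewrite -scalerAr [LHS]mxE [LHS]mxE [row _ _ _ j]mxE; congr (_ + _).
  rewrite [LHS]mxE; congr (_ * _); rewrite [LHS]mxE.
  by apply: eq_bigr => l _; rewrite [row _ _ _ l]mxE.
have sum0 (j : 'I_m.+1) : (k.+1 < j)%N ->
    \sum_l magnus_row k ord0 l * shift_mx (nth a t k).1 l j = 0.
  move=> kj; rewrite big1 // => l _; rewrite [shift_mx _ _ _]mxE.
  have [kl|lk] := ltnP k l; first by rewrite above // mul0r.
  case: eqP => [jl|_]; last by rewrite mulr0.
  by move: kj; rewrite jl ltnS ltnNge lk.
split=> [j kj|].
  by rewrite stepE above ?(ltnW kj) // sum0 // mulr0 addr0.
have ek : (inord k.+1 : 'I_m.+1) = k.+1 :> nat by rewrite inordK.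
have ek' : (inord k : 'I_m.+1) = k :> nat by rewrite inordK // ltnS ltnW.
have rest0 : \sum_(l < m.+1 | l != inord k)
    magnus_row k ord0 l * shift_mx (nth a t k).1 l (inord k.+1) = 0.
  apply: big1 => l lk; rewrite [shift_mx _ _ _]mxE ek eqSS.
  case: eqP => [kl|_]; last by rewrite mulr0.
  by case/eqP: lk; apply: val_inj; rewrite /= ek'.
rewrite stepE above ?ek // add0r (bigD1 (inord k)) // rest0.
rewrite [X in _ * X]addr0 diag.
rewrite [shift_mx _ _ _]mxE ek ek' !eqxx mulr1 (take_nth a) //.
by rewrite -cats1 big_cat big_seq1 mulrC.
Qed.

(** The corner entry of the image of [t] is the product of its exponents, which
are nonzero, while the identity matrix has a zero there. *)
Lemma reduced_separated : exists c u,
  poly_map c u /\ u (syllable_value X t) <> u 1%g.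
Proof.
have [f [fX _]] := X_basis shift_unit.
have fM : {morph (fun x => val (f x)) : x y / (x * y)%g >-> x * y}.
  by move=> x y; rewrite gmulfM.
have f1 : val (f 1%g) = 1 by rewrite gmorph1.
have uni1 (e : int) i : unitriangular (1 + e *: shift_mx i).
  move=> j k kj; rewrite !mxE; case: (_ =P j.+1) => [kj'|_].
    by move: kj; rewrite kj' ltnn.
  by rewrite mulr0 addr0.
have uf x : unitriangular (val (f x)).
  have [w ->] := free_basis_generates X_basis x.
  elim: w => [|[i b] w IH].
    rewrite /word_value big_nil f1 => j k kj.
    by rewrite mxE.
  rewrite /word_value big_cons fM; apply: unitriangularM => //=.
  case: b; last by rewrite fX val_shift_unit -(scale1r (shift_mx i)).
  by rewrite gmorphV fX val_shift_unitV -scaleN1r.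
exists (m.+1 - (ord0 : 'I_m.+1))%N, (fun x => val (f x) ord0 (inord m)).
split; first exact: unitriangular_poly_map.
have -> : val (f (syllable_value X t)) =
    \prod_(b <- take m t) (1 + b.2 *: shift_mx b.1).
  rewrite take_size /syllable_value (big_morph _ fM f1).
  apply: eq_bigr => b _; rewrite -val_shift_zpow; congr val.
  case: b => i [k|k] /=; first by rewrite gmorphX fX.
  by rewrite gmorphV gmorphX fX.
have [_] := magnus_rowE (leqnn m); rewrite mxE => ->.
rewrite f1 mxE -val_eqE /= inordK // mulr0n take_size.
apply/eqP; rewrite prodf_seq_neq0.
by case/andP: t_red.
Qed.

End Magnus.

Lemma free_group_separated (F : groupType) n (X : 'I_n -> F) (x : F) :
  free_basis X -> x <> 1 -> exists c u, poly_map c u /\ u x <> u 1.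
Proof.
move=> X_basis x1; have [w xw] := free_basis_generates X_basis x.
have [[|a s] s_red ws] := reduced_form X w.
  by case: x1; rewrite xw ws /syllable_value big_nil.
by rewrite xw ws; apply: reduced_separated.
Qed.

(** * Unipotent endomorphisms act nilpotently on polynomial maps *)

Section Derived.
Variable F : groupType.
Implicit Types (v : F -> int) (y z : F).
Local Open Scope ring_scope.

Lemma difM y z v : dif (y * z)%g v = dif y v + dif z v + dif z (dif y v).
Proof. by apply/funext=> x; rewrite /dif !fctE !mulgA; ring. Qed.

Lemma dif1 v : dif 1%g v = 0.
Proof. by apply/funext=> x; rewrite /dif mul1g subrr. Qed.

Lemma difM_mod d y z v : poly_map d.+2 v ->
  poly_map d (dif (y * z)%g v - (dif y v + dif z v)).
Proof. by move=> pv; rewrite difM addrAC subrr add0r; apply: pv. Qed.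

Lemma difM_poly_map d y z v : poly_map d.+2 v ->
  poly_map d (dif y v + dif z v) -> poly_map d (dif (y * z)%g v).
Proof.
move=> pv pyz; rewrite -(subrK (dif y v + dif z v) (dif _ v)).
exact/(killedD (@difB F))/pyz/difM_mod.
Qed.

Lemma dif_commg d y z v : poly_map d.+2 v -> poly_map d (dif [~ y, z] v).
Proof.
move=> pv.
have := difM_mod (z * y)%g [~ y, z] pv; have := difM_mod y z pv.
rewrite -commgC => e1; have e2 := difM_mod z y pv.
move=> e3.
have -> : dif [~ y, z] v = (dif (y * z)%g v - (dif y v + dif z v))
    - (dif (z * y)%g v - (dif z v + dif y v))
    - (dif (y * z)%g v - (dif (z * y)%g v + dif [~ y, z] v)).
  by apply/funext=> x; rewrite !fctE; ring.
by apply: (killedB (@difB F)) => //; apply: (killedB (@difB F)).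
Qed.

(** Modulo maps of lower degree [dif y v] is additive in [y], hence trivial on
commutators. *)
Lemma dif_derived d y v :
  y \in @derived F -> poly_map d.+2 v -> poly_map d (dif y v).
Proof.
move=> /derivedP[s ->] pv; elim: s => [|[a b] s IH].
  by rewrite big_nil dif1; apply: (killed0 (@difB F)).
rewrite big_cons; apply: difM_poly_map => //.
by apply: (killedD (@difB F)) => //=; apply: dif_commg.
Qed.

End Derived.

Section Unipotent.
Variables (F : groupType) (phi : {multiplicative F -> F}).
Implicit Types (v : F -> int) (y : F).
Local Open Scope ring_scope.

(** On the abelianization this is the endomorphism [phi - 1]. *)
Definition displacement y : F := (y^-1 * phi y)%g.

Lemma unipotent_displacement : unipotent phi ->
  exists m, forall b y, (m <= b)%N -> iter b displacement y \in @derived F.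
Proof.
move=> [m unip]; exists m => b y le_mb.
rewrite -(subnKC le_mb) iterD; move: (iter _ _ y) => {le_mb} z.
suff e : abel (iter m displacement z) =
    iter m (fun a => abel_map phi a - a) (abel z).
  by rewrite -[iter _ _ _]mul1g -invg1; apply/abelP; rewrite e unip.
elim: m {unip} => //= m <-; rewrite abel_map_abel /displacement.
by rewrite abelM abelV [RHS]addrC.
Qed.

Definition shift v : F -> int := fun x => v (phi x) - v x.

Lemma shiftB : {morph shift : u v / u - v}.
Proof. by move=> u v; apply/funext=> x; rewrite /shift !fctE; ring. Qed.

Lemma iter_shiftD a u v :
  iter a shift (u + v) = iter a shift u + iter a shift v.
Proof.
elim: a => //= a ->; apply/funext=> x; rewrite /shift !fctE; ring.
Qed.

Lemma poly_map_comp d v : poly_map d v -> poly_map d (fun x => v (phi x)).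
Proof.
apply: (@killed_twist _ _ (@dif F) (fun (u : F -> int) x => u (phi x))) => //.
move=> y u.
by exists (phi y); apply/funext=> x; rewrite /dif gmulfM.
Qed.

Lemma poly_map_shift a d v : poly_map d v -> poly_map d (iter a shift v).
Proof.
move=> pv; elim: a => //= a IH.
exact/(killedB (@difB F))/IH/poly_map_comp.
Qed.

(** How a difference passes across [phi - 1]: up to terms with two differences,
either [phi - 1] stays on the map, or the direction [y] is displaced, or both.
This is the rule for [phi - 1] acting on a tensor product. *)
Lemma dif_shift y v : let z := displacement y in
  dif y (shift v) = shift (dif y v) + shift (dif z v) + dif z v
    + (shift (dif z (dif y v)) + dif z (dif y v)).
Proof.
set z := displacement y => /=.
have -> : dif y (shift v) = shift (dif (phi y) v) + dif (phi y) v - dif y v.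
  by apply/funext=> x; rewrite /dif /shift !fctE gmulfM; ring.
have -> : phi y = (y * z)%g by rewrite mulVKg.
rewrite difM; apply/funext=> x; rewrite /shift !fctE; ring.
Qed.

(** Applying [dif y] to a large power of [phi - 1] and expanding with
[dif_shift], each resulting term has many factors [phi - 1] outside the
difference, which lower the degree of [dif y v] by induction, or many
displacements of [y], which bring it into the derived subgroup. *)
Lemma iter_shift_poly_map d : unipotent phi ->
  exists M, forall v, poly_map d.+1 v -> poly_map d (iter M shift v).
Proof.
move=> /unipotent_displacement[m mP]; elim: d => [|d [M MP]].
  exists 1%N => v pv; apply/funext=> x /=.
  have := pv (phi x * x^-1)%g => /(congr1 (@^~ x)).
  by rewrite /dif mulgVK.
exists (M + m)%N => v pv y.
(* r counts the factors not yet moved across the difference, a those that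
   stayed outside and b the displacements; a + b + r never decreases. *)
suff main r a b : (M + m <= a + b + r)%N ->
    poly_map d (iter a shift (dif (iter b displacement y) (iter r shift v))).
  exact: (main (M + m)%N 0%N 0%N).
elim: r a b => [|r IH] a b le_Mm.
  have [le_Ma|lt_aM] := leqP M a.
    rewrite -(subnK le_Ma) iterD; apply/poly_map_shift/MP/pv.
  apply/poly_map_shift/dif_derived => //; apply: mP; lia.
rewrite [iter r.+1 _ _]/= dif_shift.
have pr : poly_map d.+2 (iter r shift v) by apply: poly_map_shift.
have addP u w : poly_map d (iter a shift u) -> poly_map d (iter a shift w) ->
    poly_map d (iter a shift (u + w)).
  by move=> pu pw; rewrite iter_shiftD; apply: (killedD (@difB F)).
apply: addP (addP _ _ (addP _ _ _ _) _) (addP _ _ _ _).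
- by rewrite -iterSr; apply: IH; lia.
- by rewrite -iterSr; apply: (IH a.+1 b.+1); lia.
- by apply: (IH a b.+1); lia.
- by rewrite -iterSr; apply/poly_map_shift/pr.
- by apply/poly_map_shift/pr.
Qed.

(** The operators by which elements of a free-by-cyclic group act on maps on the
fibre: [Some y] for a translation and [None] for the monodromy. *)
Definition affine_dif (o : option F) : (F -> int) -> F -> int :=
  if o is Some y then dif y else shift.

Lemma affine_difB o : {morph affine_dif o : u v / u - v}.
Proof. by case: o => [y|]; [apply: difB|apply: shiftB]. Qed.

(** Differences by translations lower the degree, and enough consecutive
factors [phi - 1] lower it too, so long mixed products vanish. *)
Lemma poly_map_affine d : unipotent phi ->
  exists k, forall v, poly_map d v -> killed affine_dif k v.
Proof.
move=> unip; elim: d => [|d [k kP]]; first by exists 0%N.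
have [M MP] := iter_shift_poly_map d unip.
exists (k + M)%N => v pv.
suff main j : (j <= M)%N -> killed affine_dif (k + j) (iter (M - j) shift v).
  by have := main M (leqnn M); rewrite subnn.
elim: j => [|j IH] jM; first by rewrite addn0 subn0; apply/kP/MP.
rewrite addnS => -[y|] /=.
  apply: (killed_leq affine_difB (leq_addr j k)); apply: kP.
  exact: (poly_map_shift _ pv).
by rewrite -[shift _]/(iter (M - j.+1).+1 shift v) subnSK //; apply/IH/ltnW.
Qed.

End Unipotent.

(** * Polynomial maps on a free-by-cyclic group *)

Section Extension.
Variables (G : groupType) (chi : {multiplicative G -> infinite_cyclic}).
Variables (t : G) (chi_t : chi t = 1%Z).
Local Notation F := (kernel chi).
Local Open Scope ring_scope.

Lemma chi_zpow e : chi (zpow t e) = e.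
Proof.
elim/int_ind: e => [|k IH|k IH].
- exact: gmorph1.
- rewrite (_ : Posz k.+1 = Posz k + 1); last by lia.
  by rewrite zpowS gmulfM chi_t IH; apply: addrC.
- rewrite (_ : - Posz k.+1 = - Posz k - 1); last by lia.
  by rewrite zpowP gmulfM gmorphV chi_t IH; apply: addrC.
Qed.

Lemma fibre_subproof x : in_kernel chi (x * (zpow t (chi x))^-1)%g.
Proof.
by rewrite /in_kernel gmulfM gmorphV chi_zpow mulgV.
Qed.

(** The first coordinate in the semidirect product of [F] by the powers of
[t]. *)
Definition fibre (x : G) : F := Sub _ (fibre_subproof x).

Lemma fibreM g x :
  fibre (g * x)%g = (fibre g * kernel_conj chi (zpow t (chi g)) (fibre x))%g.
Proof.
apply: val_inj => /=; rewrite gmulfM [zpow t _]zpowD invgM !mulgA.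
by rewrite mulgVK.
Qed.

(** The element [g = f t ^ j] acts on the fibre by [x |-> f * phi ^ j x], so its
difference splits into a translation by [f] and [phi ^ j - 1].  The latter is a
multiple of [phi - 1] for every integer [j]. *)
Lemma poly_map_fibre k (v : F -> int) :
  killed (affine_dif (kernel_conj chi t)) k v -> poly_map k (v \o fibre).
Proof.
set T := affine_dif _; have TB := @affine_difB _ (kernel_conj chi t).
pose c j := kernel_conj chi (zpow t j).
have cD i j x : c (i + j) x = c i (c j x).
  by apply: val_inj; rewrite /= zpowD invgM !mulgA.
have c1 x : kernel_conj chi t x = c 1 x.
  by apply: val_inj; rewrite /= expg1.
have cM j x y : c j (x * y)%g = (c j x * c j y)%g by exact: gmulfM.
have twist j d w : killed T d w -> killed T d (w \o c j).
  apply: (@killed_twist _ _ T (fun (u : F -> int) x => u (c j x)) d w) => //.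
  move=> [y|] u.
    by exists (Some (c j y)); apply/funext=> x; rewrite /= /dif cM.
  exists None; apply/funext=> x; rewrite /= /shift /=.
  by rewrite !c1 -!cD (addrC j).
have drop j d w : killed T d.+1 w -> killed T d (w \o c j - w).
  move=> kw; have kE : killed T d (shift (kernel_conj chi t) w) := kw None.
  elim/int_ind: j => [|i IH|i IH].
  - rewrite (_ : _ - _ = 0); first exact: killed0.
    apply/funext=> x; rewrite !fctE /= (_ : c 0 x = x) ?subrr //.
    by apply: val_inj; rewrite /= expg0 invg1 mul1g mulg1.
  - rewrite (_ : _ - _ = shift (kernel_conj chi t) w \o c i + (w \o c i - w)).
      by apply: killedD => //; apply: twist.
    apply/funext=> x; rewrite !fctE /= /shift /= c1 -cD.
    by rewrite (_ : 1 + Posz i = i.+1)%R; [ring|lia].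
  - pose e : int := - Posz i.+1.
    rewrite (_ : _ - _ = (w \o c (- Posz i) - w)
        - (shift (kernel_conj chi t) w \o c e)).
      by apply: killedB => //; apply: twist.
    apply/funext=> x; rewrite !fctE /= /shift /= c1 -cD.
    by rewrite (_ : 1 + e = - Posz i)%R; [ring|rewrite /e; lia].
elim: k v => [|k IH] v kv; first by rewrite /= kv.
move=> g.
rewrite (_ : dif g _ =
    (dif (fibre g) v \o c (chi g) + (v \o c (chi g) - v)) \o fibre).
  apply: IH; apply: killedD => //; last exact: drop.
  by apply: twist; apply: (kv (Some (fibre g))).
by apply/funext=> x; rewrite /dif !fctE /= fibreM /dif /c; ring.
Qed.

Lemma free_by_cyclic_separated n (X : 'I_n -> F) (x : G) :
    free_basis X -> unipotent (kernel_conj chi t) -> x <> 1%g ->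
  exists c u, poly_map c u /\ u x <> u 1%g.
Proof.
move=> X_basis unip x1.
have [chix|chix] := eqVneq (chi x) 0; last first.
  exists 2%N, (fun y => chi y : int); split; last by rewrite gmorph1; apply/eqP.
  have e (a b c : int) : a + (b + c) - (b + c) - (a + c - c) = 0 by ring.
  by move=> g h /=; apply/funext=> y; rewrite /dif !gmulfM; apply: e.
have fx : val (fibre x) = x by rewrite /= chix /= expg0 invg1 mulg1.
have [|d [v [pv vx]]] := free_group_separated (x := fibre x) X_basis.
  by move=> e; apply: x1; rewrite -fx e.
have [k kP] := poly_map_affine d unip.
exists k, (v \o fibre); split; first exact/poly_map_fibre/kP.
rewrite /= (_ : fibre 1%g = 1%g) //; apply: val_inj.
by rewrite /= gmorph1 mul1g invg1.
Qed.

End Extension.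

(** * Quotients that keep elements and cyclic subgroups apart *)

Section ResiduallyPolynomial.
Variable G : groupType.
Hypothesis separated : forall x : G, x <> 1 ->
  exists c u, poly_map c u /\ u x <> u 1.
Implicit Types (x y g h : G).

Lemma congruence_map_neq x y : x <> y ->
  exists N, forall p, (N < p)%N -> congruence_map p x <> congruence_map p y.
Proof.
move=> xy; have [|c [u [pu ux]]] := @separated (x / y).
  by move=> /divg1_eq.
exists (maxn c `|(u (x / y)%g - u 1%g)%R|) => p.
rewrite gtn_max => /andP[cp np].
move=> /congruence_mapP/(_ u) cxy.
have := cxy (killed_leq (@difB G) (ltnW cp) pu) y^-1; rewrite mulgV dvdzE /=.
by rewrite gtnNdvd // absz_gt0 subr_eq0; apply/eqP.
Qed.

Lemma congruence_map_neq1 x : x <> 1 ->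
  exists N, forall p, (N < p)%N -> congruence_map p x <> 1.
Proof.
move=> /congruence_map_neq[N NP]; exists N => p /NP.
by rewrite gmorph1.
Qed.

(** Start from a map that moves under [g] and apply [dif g] as long as the
result still moves; replacing it by its opposite fixes the sign. *)
Lemma linear_along g : g <> 1 -> exists c u y,
  [/\ poly_map c u, dif g (dif g u) = 0%R & (0 < dif g u y)%R].
Proof.
move=> /separated[c [u [pu ug]]].
have : dif g u <> 0%R.
  move=> /(congr1 (@^~ 1)); rewrite /dif mulg1 => /eqP.
  by rewrite subr_eq0 => /eqP.
elim: c u pu {ug} => [|c IH] u pu du0.
  case: du0; rewrite /= in pu; rewrite pu.
  by apply/funext=> x; rewrite /dif subrr.
have [ddu0|ddu0] := pselect (dif g (dif g u) = 0%R); last exact: (IH _ (pu g)).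
have [y uy] : exists y, dif g u y <> 0%R.
  by apply: contrapT => no; apply: du0; apply/funext=> y; apply: contrapT => uy;
     apply: no; exists y.
have [uy0|uy0] := ltP 0%R (dif g u y); first by exists c.+1, u, y.
have dN v : dif g (- v)%R = (- dif g v)%R.
  by apply/funext=> x; rewrite /dif !fctE; ring.
exists c.+1, (- u)%R, y; split.
- exact: (killedN (@difB G)).
- by rewrite !dN ddu0 oppr0.
- by rewrite dN fctE oppr_gt0 lt_neqAle uy0 andbT; apply/eqP.
Qed.

Lemma linear_expg g u k y : dif g (dif g u) = 0%R ->
  u (g ^+ k * y) = (u y + dif g u y *+ k)%R.
Proof.
move=> du; rewrite (@dif_expg _ 2 g u k y du) big_ord_recl big_ord1 /=.
by rewrite bin0 bin1 mulr1n.
Qed.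

Lemma torsion_free h k : h <> 1 -> (0 < k)%N -> h ^+ k <> 1.
Proof.
move=> /linear_along[c [u [y [_ du uy]]]] k0 hk.
have := linear_expg k y du; rewrite hk mul1g => /eqP.
rewrite -subr_eq0 opprD addrA subrr add0r oppr_eq0 mulrn_eq0 eqn0Ngt k0 /=.
by rewrite gt_eqF.
Qed.

(** The exponents [al] and [be] in the proof come from a polynomial map alone,
so the single pair [h ^+ al], [zpow g be] is tested for all large primes. *)
Lemma congruence_map_meet g h :
    cyclic_subgroup g `&` cyclic_subgroup h = [set 1] \/ [~ g, h] <> 1 ->
  exists N, forall p, prime p -> (N < p)%N ->
    cyclic_subgroup (congruence_map p g) `&`
      cyclic_subgroup (congruence_map p h) = [set 1].
Proof.
have power p : prime p ->
    cyclic_subgroup (congruence_map p g) `&`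
      cyclic_subgroup (congruence_map p h) <> [set 1] ->
    exists k, congruence_map p h = congruence_map p g ^+ k.
  move=> p_pr; apply: (cyclic_meet_generator p_pr) => a.
  exact: congruence_quotient_exponent.
move=> [gh|/congruence_map_neq1[N NP]]; last first.
  exists N => p p_pr /NP pgh; apply: contrapT => /(power p p_pr)[k hk].
  apply: pgh; rewrite commgEl conjgE !gmulfM !gmorphV hk.
  have := commuteX k (commute_refl (congruence_map p g)).
  by rewrite /commute => ->; rewrite mulKg mulVg.
have [h1|h1] := pselect (h = 1).
  exists 0%N => p p_pr _; rewrite h1 gmorph1; apply/seteqP; split=> x /=.
    by move=> [_ [k []]->]; rewrite expg1n ?invg1.
  by move=> ->; split; exists 0%N; left; rewrite expg0.
have [g1|g1] := pselect (g = 1).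
  exists 0%N => p p_pr _; rewrite g1 gmorph1; apply/seteqP; split=> x /=.
    by move=> [[k []->]]; rewrite expg1n ?invg1.
  by move=> ->; split; exists 0%N; left; rewrite expg0.
have [c [u [y [pu du uy]]]] := linear_along g1.
pose al := `|dif g u y|; pose be : int := dif h u y.
have alE : Posz al = dif g u y by rewrite /al gez0_abs // ltW.
have al0 : (0 < al)%N by rewrite absz_gt0 gt_eqF.
have [|N NP] := @congruence_map_neq (h ^+ al) (zpow g be).
  move=> e; apply: (torsion_free h1 al0).
  have : (cyclic_subgroup g `&` cyclic_subgroup h) (h ^+ al).
    by split; [rewrite e; apply: zpow_cyclic|exists al; left].
  by rewrite gh.
exists (maxn N c) => p p_pr; rewrite gtn_max => /andP[/NP neq cp].
apply: contrapT => /(power p p_pr)[k hk]; case: neq.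
have exp_p := congruence_quotient_exponent (congruence_map p g) p_pr.
rewrite gmorph_zpow gmorphX hk -expgnA.
suff: (p %| (Posz (k * al) - be)%R)%Z by exact: zpow_modp.
have /congruence_mapP cong : congruence_map p h = congruence_map p (g ^+ k).
  by rewrite gmorphX.
have := cong u (killed_leq (@difB G) (ltnW cp) pu) y.
rewrite (linear_expg k y du) -rpredN => dv.
rewrite (_ : _ - be = - (u (h * y)%g - (u y + dif g u y *+ k)))%R //.
rewrite PoszM alE /be /dif -mulr_natr natz; ring.
Qed.

End ResiduallyPolynomial.

Theorem proposition4 (R : realType) (G : groupType)
    (chi : {multiplicative G -> infinite_cyclic}) (chi_epi : surjectiveg chi)
    (n : nat) (X : 'I_n -> kernel chi) (X_basis : free_basis X)
    (t : G) (chi_t : chi t = 1%Z)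
    (unip : unipotent (kernel_conj chi t))
    (growth : polynomially_growing R X (kernel_conj chi t))
    (S : seq G) (S_nontrivial : forall s, s \in S -> s <> 1)
    (g h : G)
    (gh : cyclic_subgroup g `&` cyclic_subgroup h = [set 1] \/ [~ g, h] <> 1) :
  exists N : nat, forall p : nat, prime p -> (N < p)%N ->
    exists (Q : groupType) (pi : {multiplicative G -> Q}),
      [/\ periodic p Q,
          surjectiveg pi,
          forall s, s \in S -> pi s <> 1
        & cyclic_subgroup (pi g) `&` cyclic_subgroup (pi h) = [set 1]].
Proof.
have separated (x : G) : x <> 1 -> exists c u, poly_map c u /\ u x <> u 1.
  exact: free_by_cyclic_separated chi_t _ X x X_basis unip.
have [N1 N1P] := congruence_map_meet separated gh.
have [N2 N2P] : exists N, forall p, (N < p)%N ->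
    forall s, s \in S -> congruence_map p s <> 1.
  elim: S S_nontrivial => [|s S IH] Sn; first by exists 0%N.
  have [N NP] : exists N, forall p, (N < p)%N ->
      forall s, s \in S -> congruence_map p s <> 1.
    by apply: IH => s' s'S; apply: Sn; rewrite inE s'S orbT.
  have [M MP] := congruence_map_neq1 separated (Sn s (mem_head _ _)).
  exists (maxn N M) => p; rewrite gtn_max => /andP[Np Mp] s'.
  by rewrite inE => /predU1P[->|]; [apply: MP|apply: NP].
exists (maxn N1 N2) => p p_pr; rewrite gtn_max => /andP[N1p N2p].
exists (congruence_quotient G p), (congruence_map p); split.
- apply: prime_exponent_periodic => // a.
  exact: congruence_quotient_exponent.
- exact: congruence_map_surj.
- exact: N2P.
- exact: N1P.
Qed.
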